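(* Let $\lambda>0$, $V=(V^x,V^y)\in\mathbb{R}^2$, $(s_q,s_{xy})\in\mathbb{R}^2$. Consider the twisted $D_2Q_4$ scheme relative to $\tilde u=V$ with relaxation parameters $(0,s_q,s_q,s_{xy})$ and equilibrium moments $m^{eq}(V)=\rho(1,0,0,-V^xV^y)$. Put $W^x=V^x+V^y$, $W^y=V^x-V^y$ and, when $s_q\neq s_{xy}$, $\gamma_1=(2s_q-s_{xy})/(s_q-s_{xy})$, $\gamma_2=s_{xy}/(s_q-s_{xy})$. All inequalities below are required for both choices of sign (upper signs together, lower signs together). \begin{itemize} \item If $s_q<s_{xy}\le\min(2s_q,2(2-s_q))$, the scheme is $L^\infty$ stable for all $V$ such that $$(W^x\pm\lambda\gamma_1)^2-(W^y)^2\le\lambda^2\gamma_1\gamma_2,$$ $$\Big(W^x\pm\lambda\frac{\gamma_1+\gamma_2}2\Big)^2-(W^y\pm\lambda)^2\le\lambda^2\gamma_2^2,$$ $$\Big(W^x\pm\lambda\frac{\gamma_1+\gamma_2}2\Big)^2-(W^y\mp\lambda)^2\le\lambda^2\gamma_2^2,$$ $$(W^x\pm\lambda\gamma_2)^2-(W^y)^2\le\frac{\lambda^2}{(s_q-s_{xy})^2}\big(4s_q^2-2s_qs_{xy}-s_{xy}^2+8(s_{xy}-s_q)\big),$$ together with the analogous inequalities obtained by exchanging $W^x$ and $W^y$. \item If $s_{xy}\le\min(s_q,2(2-s_q))$ and $s_{xy}\ne s_q$, the scheme is $L^\infty$ stable for all $V$ such that $$(W^x\pm\lambda\gamma_1)^2-(W^y)^2\ge\lambda^2\gamma_1\gamma_2,$$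 $$\Big(W^x\pm\lambda\frac{\gamma_1+\gamma_2}2\Big)^2-(W^y\pm\lambda)^2\ge\lambda^2\gamma_2^2,$$ $$\Big(W^x\pm\lambda\frac{\gamma_1+\gamma_2}2\Big)^2-(W^y\mp\lambda)^2\ge\lambda^2\gamma_2^2,$$ $$(W^x\pm\lambda\gamma_2)^2-(W^y)^2\ge\frac{\lambda^2}{(s_q-s_{xy})^2}\big(4s_q^2-2s_qs_{xy}-s_{xy}^2+8(s_{xy}-s_q)\big),$$ together with the analogous inequalities obtained by exchanging $W^x$ and $W^y$. \item If $s_{xy}=s_q$: for $0\le s_q\le1$ the scheme is $L^\infty$ stable for all $V$ with $|V|_1\le\lambda$; for $1\le s_q\le4/3$ it is $L^\infty$ stable for all $V$ with $|V|_1\le\lambda(\frac4{s_q}-3)$; for other values of $s_q$ there is no $V$ for which it is $L^\infty$ stable. \item For all other $(s_q,s_{xy})$, there is no $V$ for which the scheme is $L^\infty$ stable. \end{itemize} In particular, the parameters $(s_q,s_{xy})$ for which the set of $V$ giving an $L^\infty$ stable scheme is non-empty are included in the square $[0,2]^2$.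
   Context: $|V|_1=|V^x|+|V^y|$. Twisted $D_2Q_4$ scheme. Let $\Delta x,\Delta t>0$, $\lambda=\Delta x/\Delta t$, $\mathcal{L}=\Delta x\,\mathbb{Z}^2$. Velocities: $v_0=(\lambda,\lambda)$, $v_1=(-\lambda,\lambda)$, $v_2=(-\lambda,-\lambda)$, $v_3=(\lambda,-\lambda)$. Moment polynomials: $P_0=1$, $P_1=X$, $P_2=Y$, $P_3=XY$. For $\tilde u\in\mathbb{R}^2$, $M(\tilde u)$ is the invertible $4\times4$ matrix $M(\tilde u)_{kj}=P_k(v_j-\tilde u)$. For a distribution vector $f=(f_0,\dots,f_3)$ put $\rho=\sum_jf_j$ and $m=M(\tilde u)f$. One time step of the scheme relative to $\tilde u$ with relaxation parameters $(s_0,\dots,s_3)$ is: relaxation at each node $m_k^*=m_k+s_k(m_k^{eq}-m_k)$, where $m^{eq}$ is a given linear function of $\rho$; $f^*=M(\tilde u)^{-1}m^*$; transport $f_j(x,t+\Delta t)=f_j^*(x-v_j\Delta t,t)$, $x\in\mathcal{L}$. $L^\infty$ stability. The mass is $m_{tot}(t)=\sum_{x\in\mathcal{L}}\sum_jf_j(x,t)$. The scheme is $L^\infty$ stable if, for $C>0$ and every initial datum with $f_j(x,0)\ge0$ for all $j$, $x\in\mathcal{L}$ and $m_{tot}(0)\le C$, one has $f_j(x,t^n)\ge0$ for all $j$, $x\in\mathcal{L}$ and $m_{tot}(t^n)\le C$ for all $t^n=n\Delta t$, $n\in\mathbb{N}$. *)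

(* Defs.v *)
From mathcomp Require Import all_boot all_order all_algebra.
From mathcomp Require Import all_classical all_reals all_analysis.
From mathcomp Require Import ring.

Set Implicit Arguments.
Unset Strict Implicit.
Unset Printing Implicit Defensive.

Import Order.TTheory GRing.Theory Num.Theory.

Local Open Scope classical_set_scope.
Local Open Scope ring_scope.

Section TwistedD2Q4.
Variable R : realType.
Implicit Types (dx dt lam : R) (u x p : R * R) (s : 'cV[R]_4).

Definition lattice dx : set (R * R) :=
  [set x | exists i j : int, x = (i%:~R * dx, j%:~R * dx)].

Definition velocity lam (j : 'I_4) : R * R :=
  (lam * [:: 1; -1; -1; 1]`_j, lam * [:: 1; 1; -1; -1]`_j).

Definition moment_poly (k : 'I_4) p : R := [:: 1; p.1; p.2; p.1 * p.2]`_k.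

Definition moment_mx lam u : 'M[R]_4 :=
  \matrix_(k, j) moment_poly k (velocity lam j - u).

Definition density (f : 'cV[R]_4) : R := \sum_j f j ord0.

Definition relaxation lam u s (meq : R -> 'cV[R]_4) (f : 'cV[R]_4) : 'cV[R]_4 :=
  let m := moment_mx lam u *m f in
  let mstar := \col_k
    (m k ord0 + s k ord0 * (meq (density f) k ord0 - m k ord0)) in
  invmx (moment_mx lam u) *m mstar.

(* Distributions are total functions on the plane, but a step maps [x] to
   values at the points [x - dt v_j], which lie in [lattice dx] when [x] does
   and [lam = dx / dt]; only the values on the lattice are ever constrained. *)
Definition scheme_step dx dt u s (meq : R -> 'cV[R]_4)
    (f : R * R -> 'cV[R]_4) : R * R -> 'cV[R]_4 :=
  let lam := dx / dt in
  fun x => \col_j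
    (let v := velocity lam j in
     relaxation lam u s meq (f (x.1 - v.1 * dt, x.2 - v.2 * dt)) j ord0).

Definition nonneg_on_lattice dx (f : R * R -> 'cV[R]_4) : Prop :=
  forall x, lattice dx x -> forall j, 0 <= f x j ord0.

(* [esum] is the intended sum of the series only for nonnegative terms; below
   it always occurs together with [nonneg_on_lattice]. It may be [+oo]. *)
Definition total_mass dx (f : R * R -> 'cV[R]_4) : \bar R :=
  (\esum_(x in lattice dx) (density (f x))%:E)%E.

Definition Linf_stable dx dt u s (meq : R -> 'cV[R]_4) : Prop :=
  forall (C : R) (f : R * R -> 'cV[R]_4), 0 < C ->
    nonneg_on_lattice dx f -> (total_mass dx f <= C%:E)%E ->
    forall n : nat,
      let fn := iter n (scheme_step dx dt u s meq) f in
      nonneg_on_lattice dx fn /\ (total_mass dx fn <= C%:E)%E.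

Definition relax_params (sq sxy : R) : 'cV[R]_4 :=
  \col_k [:: 0; sq; sq; sxy]`_k.

Definition equilibrium (V : R * R) (rho : R) : 'cV[R]_4 :=
  rho *: \col_k [:: 1; 0; 0; - (V.1 * V.2)]`_k.

Definition scheme_stable dx dt (sq sxy : R) (V : R * R) : Prop :=
  Linf_stable dx dt V (relax_params sq sxy) (equilibrium V).

Definition l1norm (V : R * R) : R := `|V.1| + `|V.2|.

Definition gamma1 (sq sxy : R) : R := (2 * sq - sxy) / (sq - sxy).
Definition gamma2 (sq sxy : R) : R := sxy / (sq - sxy).

(* [rel a b] is [a <= b] in one case and [a >= b] in the other;
   [e = 1] gives the upper signs and [e = -1] the lower ones. *)
Definition velocity_ineqs (rel : R -> R -> bool) lam (sq sxy Wx Wy : R) : Prop :=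
  let g1 := gamma1 sq sxy in
  let g2 := gamma2 sq sxy in
  forall e : R, e = 1 \/ e = -1 ->
  [/\ rel ((Wx + e * (lam * g1)) ^+ 2 - Wy ^+ 2) (lam ^+ 2 * g1 * g2),
      rel ((Wx + e * (lam * ((g1 + g2) / 2))) ^+ 2 - (Wy + e * lam) ^+ 2)
          (lam ^+ 2 * g2 ^+ 2),
      rel ((Wx + e * (lam * ((g1 + g2) / 2))) ^+ 2 - (Wy - e * lam) ^+ 2)
          (lam ^+ 2 * g2 ^+ 2)
    & rel ((Wx + e * (lam * g2)) ^+ 2 - Wy ^+ 2)
          (lam ^+ 2 / (sq - sxy) ^+ 2 *
             (4 * sq ^+ 2 - 2 * sq * sxy - sxy ^+ 2 + 8 * (sxy - sq)))].

Definition stability_region (rel : R -> R -> bool) lam (sq sxy : R)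
    (V : R * R) : Prop :=
  let Wx := V.1 + V.2 in
  let Wy := V.1 - V.2 in
  velocity_ineqs rel lam sq sxy Wx Wy /\ velocity_ineqs rel lam sq sxy Wy Wx.

Lemma moment_mx_unit lam u : lam != 0 -> moment_mx lam u \in unitmx.
Proof.
move=> lam0.
pose N : 'M[R]_4 := \matrix_(j, k)
  (let a := [:: 1; -1; -1; 1 : R]`_j / lam in
   let b := [:: 1; 1; -1; -1 : R]`_j / lam in
   [:: (1 + a * u.1) * (1 + b * u.2); a * (1 + b * u.2);
       b * (1 + a * u.1); a * b]`_k / 4).
suff /mulmx1_unit[] : moment_mx lam u *m N = 1%:M by [].
apply/matrixP => i k; rewrite !mxE !big_ord_recl big_ord0 !mxE.
by case: i => [[|[|[|[|//]]]] ?]; case: k => [[|[|[|[|//]]]] ?];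
   rewrite /moment_poly /velocity /=; field.
Qed.

End TwistedD2Q4.

(* Main.v *)
Require Import Defs.
From mathcomp Require Import all_boot all_order all_algebra.
From mathcomp Require Import all_classical all_reals all_analysis.
From mathcomp Require Import ring lra.
Import Order.TTheory GRing.Theory Num.Theory.
Local Open Scope ring_scope.

(** One collision acts on the densities of a node as a fixed 4 x 4 matrix A
whose columns sum to 1, since the density is a conserved moment; transport
permutes the lattice separately for each velocity. Stability is therefore
equivalent to nonnegativity of the entries of A ([Linf_stable_mx]): one step
from a unit point mass exhibits a whole column of A, and a nonnegative A keeps
the distributions nonnegative and preserves the total mass.

For the twisted scheme put (a, b) = V / lam, let (X, Y) and (x, y) be the signs
of the outgoing and incoming velocities, p = X x, q = Y y, A = X a, B = Y b.
The entry of the collision matrix is then a quarter of a polynomial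
[weight sq sxy p q A B], affine in each argument and involving the signs only
through p, q, A, B ([relaxation_collision]).
- When sq != sxy, completing the product 2 (sq - sxy) A B to a difference of
  squares in W^x, W^y turns the sixteen conditions [0 <= weight] into the
  sixteen inequalities of the stability region, with the direction given by the
  sign of sq - sxy ([weight_ge0_of_velocity_ineqs]).
- When sq = sxy the product A B disappears, and what is left is controlled by
  the l1 norm of (a, b).
- Summing over the four outgoing velocities at fixed (p, q) kills every term in
  A, B and A B, as (X, Y) runs over all pairs of signs. Stability
  for any V thus forces three inequalities on (sq, sxy) alone
  ([relax_params_bounds]), and all the nonexistence claims follow from them. *)

(** * Stability of schemes with a linear collision *)

Section LinearScheme.
Context {R : realType} (dx dt : R) (hdt : 0 < dt).
Implicit Types (f : R * R -> 'cV[R]_4) (x : R * R) (j : 'I_4).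

Definition shift j x : R * R :=
  let v := velocity (dx / dt) j in (x.1 - v.1 * dt, x.2 - v.2 * dt).

Lemma velocity_dt_lattice j :
  exists a b : int, (velocity (dx / dt) j).1 * dt = a%:~R * dx /\
                    (velocity (dx / dt) j).2 * dt = b%:~R * dx.
Proof.
have dt0 : dt != 0 by rewrite gt_eqF.
case: j => [[|[|[|[|//]]]] ?]; rewrite /velocity /=;
  [exists 1, 1 | exists (-1), 1 | exists (-1), (-1) | exists 1, (-1)];
  by split; rewrite ?mulrN1z ?mulr1z; field.
Qed.

Lemma shift_bij j : set_bij (lattice dx) (lattice dx) (shift j).
Proof.
have [a [b [va vb]]] := velocity_dt_lattice j; rewrite /shift va vb; split.
- move=> _ [m [n ->]]; exists (m - a), (n - b) => /=.
  by rewrite !intrB !mulrBl.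
- by move=> [x1 x2] [y1 y2] _ _ /= [/addIr -> /addIr ->].
- move=> _ [m [n ->]]; exists ((m + a)%:~R * dx, (n + b)%:~R * dx).
    by exists (m + a), (n + b).
  by rewrite /= !intrD !mulrDl !addrK.
Qed.

Context (u : R * R) (s : 'cV[R]_4) (meq : R -> 'cV[R]_4) (A : 'M[R]_4).
Hypothesis relaxationE : forall g, relaxation (dx / dt) u s meq g = A *m g.
Hypothesis A_col_sum : forall i, \sum_j A j i = 1.

Lemma density_mulmx (g : 'cV[R]_4) : density (A *m g) = density g.
Proof.
rewrite /density; under eq_bigr do rewrite mxE.
rewrite exchange_big /=; apply: eq_bigr => i _.
by rewrite -mulr_suml A_col_sum mul1r.
Qed.

Lemma scheme_stepE f x j :
  scheme_step dx dt u s meq f x j ord0 = (A *m f (shift j x)) j ord0.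
Proof. by rewrite /scheme_step [LHS]mxE /= relaxationE. Qed.

Section NonnegativeCollision.
Hypothesis A_ge0 : forall j i, 0 <= A j i.

Lemma mulmx_ge0 (g : 'cV[R]_4) :
  (forall i, 0 <= g i ord0) -> forall j, 0 <= (A *m g) j ord0.
Proof. by move=> g0 j; rewrite mxE sumr_ge0// => i _; rewrite mulr_ge0. Qed.

Lemma scheme_step_nonneg f :
  nonneg_on_lattice dx f -> nonneg_on_lattice dx (scheme_step dx dt u s meq f).
Proof.
move=> f0 x Lx j; rewrite scheme_stepE; apply: mulmx_ge0 => i.
by apply: f0; have [+ _ _] := shift_bij j; apply.
Qed.

(** The series has nonnegative terms, so it may be split by velocity; each
part is a sum over the whole lattice, which absorbs the shift. *)
Lemma scheme_step_mass f : nonneg_on_lattice dx f ->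
  total_mass dx (scheme_step dx dt u s meq f) = total_mass dx f.
Proof.
move=> f0; rewrite /total_mass.
transitivity (\sum_j \esum_(x in lattice dx) ((A *m f x) j ord0)%:E)%E.
  rewrite (eq_esum (b := fun x =>
    (\sum_j ((A *m f (shift j x)) j ord0)%:E)%E)); last first.
    move=> x _; rewrite sumEFin; congr EFin.
    by apply: eq_bigr => j _; rewrite scheme_stepE.
  rewrite esum_sum; last first.
    move=> x j Lx _; rewrite lee_fin; apply: mulmx_ge0 => i.
    by apply: f0; have [+ _ _] := shift_bij j; apply.
  apply: eq_bigr => j _.
  by rewrite [RHS](reindex_esum _ _ _ _ (shift_bij j)).
rewrite -esum_sum; last first.
  by move=> x j Lx _; rewrite lee_fin; apply: mulmx_ge0 => i; exact: f0.
by apply: eq_esum => x _; rewrite sumEFin -[in RHS]density_mulmx.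
Qed.

End NonnegativeCollision.

Definition point_mass (i : 'I_4) x : 'cV[R]_4 :=
  if x == (0, 0) then delta_mx i ord0 else 0.

Lemma point_mass_nonneg i : nonneg_on_lattice dx (point_mass i).
Proof.
by move=> x _ j; rewrite /point_mass; case: ifP => _; rewrite mxE// ler0n.
Qed.

Lemma density_delta i : density (delta_mx i ord0) = 1 :> R.
Proof.
rewrite /density (bigD1 i)//= big1 ?addr0 => [|j /negPf ji].
  by rewrite mxE !eqxx.
by rewrite mxE ji.
Qed.

Lemma point_mass_total i : total_mass dx (point_mass i) = 1%E.
Proof.
have L0 : lattice dx (0, 0) by exists 0, 0; rewrite !mul0r.
rewrite /total_mass.
rewrite (eq_esum (b := fun x => if x \in [set (0, 0)]%classic then 1%E else 0%E)).
  rewrite -esum_mkcondr (_ : (_ `&` _)%classic = [set (0, 0)]%classic).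
    by rewrite esum_set1.
  by apply/seteqP; split => [x []|x ->].
move=> x _; rewrite /point_mass classical_sets.in_set1; case: ifP => _.
  by rewrite density_delta.
by rewrite /density big1// => j _; rewrite mxE.
Qed.

(** For necessity, one step from a point mass moving with velocity i puts
[A j i] at the end of velocity j. *)
Lemma Linf_stable_mx :
  Linf_stable dx dt u s meq <-> (forall j i, 0 <= A j i).
Proof.
split=> [stable j i|A0 C f C0 f0 fC n]; last first.
  suff [fn0 fnE] : nonneg_on_lattice dx (iter n (scheme_step dx dt u s meq) f) /\
      total_mass dx (iter n (scheme_step dx dt u s meq) f) = total_mass dx f.
    by split=> //; rewrite fnE.
  elim: n => [//|n [IH0 IHm]] /=; split; first exact: scheme_step_nonneg.
  by rewrite scheme_step_mass.
have [] := stable 1 (point_mass i) ltr01 (point_mass_nonneg i) _ 1%N.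
  by rewrite point_mass_total.
set v := velocity (dx / dt) j.
have Lv : lattice dx (v.1 * dt, v.2 * dt).
  by have [a [b [-> ->]]] := velocity_dt_lattice j; exists a, b.
move=> /(_ _ Lv j) + _; rewrite /= scheme_stepE /shift /= !subrr.
by rewrite /point_mass eqxx -colE mxE.
Qed.

End LinearScheme.

(** * The collision matrix of the twisted scheme *)

Section Twisted.
Context {R : realType}.
Implicit Types (lam sq sxy s r a b p q : R) (V : R * R) (i j : 'I_4).

(** Four times the fraction of the density that a collision sends from the
velocity with signs (x, y) to the one with signs (X, Y), where p = X x, q = Y y,
a = X V^x / lam and b = Y V^y / lam. *)
Definition weight sq sxy p q a b : R :=
  1 + p * (1 - sq) + q * (1 - sq) + p * q * (1 - sxy) + sq * (a + b)
  - (sq - sxy) * (q * a + p * b - 2 * a * b).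

Definition dirx j : R := [:: 1; -1; -1; 1]`_j.
Definition diry j : R := [:: 1; 1; -1; -1]`_j.

Definition collision_mx lam sq sxy V : 'M[R]_4 :=
  \matrix_(j, i) (weight sq sxy (dirx j * dirx i) (diry j * diry i)
                    (dirx j * (V.1 / lam)) (diry j * (V.2 / lam)) / 4).

(** Checked in moments, where relaxation is diagonal, so that the inverse of
the moment matrix never has to be computed. *)
Lemma relaxation_collision lam sq sxy V (f : 'cV[R]_4) : lam != 0 ->
  relaxation lam V (relax_params sq sxy) (equilibrium V) f =
  collision_mx lam sq sxy V *m f.
Proof.
move=> lam0; rewrite /relaxation; set mstar := \col_k _.
suff -> : mstar = moment_mx lam V *m (collision_mx lam sq sxy V *m f).
  by rewrite mulKmx// moment_mx_unit.
apply/matrixP => k l; rewrite ord1 {l} /mstar !mxE /density.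
rewrite !(big_ord_recl, big_ord0) !mxE !(big_ord_recl, big_ord0) !mxE.
case: k => [[|[|[|[|//]]]] ?];
  rewrite /moment_poly /velocity /weight /dirx /diry /=; by field.
Qed.

Lemma collision_col_sum lam sq sxy V i :
  \sum_j collision_mx lam sq sxy V j i = 1.
Proof.
rewrite !(big_ord_recl, big_ord0) !mxE /weight /dirx /diry /=.
by set a := V.1 / lam; set b := V.2 / lam; field.
Qed.

Lemma scheme_stableP dx dt sq sxy V : 0 < dx -> 0 < dt ->
  scheme_stable dx dt sq sxy V <->
  (forall j i, 0 <= collision_mx (dx / dt) sq sxy V j i).
Proof.
move=> dx0 dt0; apply: Linf_stable_mx => // [f|i].
  by rewrite relaxation_collision// mulf_neq0 ?invr_eq0 ?gt_eqF.
exact: collision_col_sum.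
Qed.

(** * Signs of the entries *)

(** Each left side minus right side is [2 lam ^ 2 / (sq - sxy)] times one of the
four weights; the hypothesis on [rel] absorbs the sign of [sq - sxy]. *)
Lemma weight_ge0_of_velocity_ineqs (rel : R -> R -> bool) lam sq sxy a b :
  (forall x y, rel x y -> 0 <= (x - y) * (sq - sxy)) ->
  0 < lam -> sxy != sq ->
  velocity_ineqs rel lam sq sxy (lam * (a + b)) (lam * (a - b)) ->
  forall e, e = 1 \/ e = -1 ->
  [/\ 0 <= weight sq sxy (-1) (-1) (e * a) (e * b),
      0 <= weight sq sxy (-1) 1 (e * a) (e * b),
      0 <= weight sq sxy 1 (-1) (e * a) (e * b)
    & 0 <= weight sq sxy 1 1 (e * a) (e * b)].
Proof.
move=> hrel lam0 neq ineqs e he.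
have d0 : sq - sxy != 0 by rewrite subr_eq0 eq_sym.
have lam_neq0 : lam != 0 by rewrite gt_eqF.
have k0 : 0 < 2 * lam ^+ 2 by rewrite mulr_gt0// exprn_gt0.
have [/hrel h1 /hrel h2 /hrel h3 /hrel h4] := ineqs e he.
split; rewrite -(pmulr_rge0 _ k0).
- move: h1; congr (0 <= _).
  by rewrite /weight /gamma1 /gamma2; case: he => ->; field.
- move: h2; congr (0 <= _).
  by rewrite /weight /gamma1 /gamma2; case: he => ->; field.
- move: h3; congr (0 <= _).
  by rewrite /weight /gamma1 /gamma2; case: he => ->; field.
- move: h4; congr (0 <= _).
  by rewrite /weight /gamma1 /gamma2; case: he => ->; field.
Qed.

(** Exchanging W^x and W^y amounts to replacing [b] by [- b]. The two sets of
inequalities thus cover the outgoing directions with equal, respectively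
opposite, signs. *)
Lemma collision_ge0_of_region (rel : R -> R -> bool) lam sq sxy V :
  (forall x y, rel x y -> 0 <= (x - y) * (sq - sxy)) ->
  0 < lam -> sxy != sq -> stability_region rel lam sq sxy V ->
  forall j i, 0 <= collision_mx lam sq sxy V j i.
Proof.
move=> hrel lam0 neq [ineqs ineqs'] j i.
have lam_neq0 : lam != 0 by rewrite gt_eqF.
set a := V.1 / lam; set b := V.2 / lam.
have V1 : V.1 = lam * a by rewrite /a mulrC divfK.
have V2 : V.2 = lam * b by rewrite /b mulrC divfK.
have W := weight_ge0_of_velocity_ineqs rel lam sq sxy a b hrel lam0 neq.
have W' := weight_ge0_of_velocity_ineqs rel lam sq sxy a (- b) hrel lam0 neq.
rewrite opprK in W'.
move: ineqs ineqs'; rewrite V1 V2 -mulrDr -mulrBr => /W {}W /W' {}W'.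
have [p1 p2 p3 p4] := W 1 (or_introl erefl).
have [q1 q2 q3 q4] := W (-1) (or_intror erefl).
have [r1 r2 r3 r4] := W' 1 (or_introl erefl).
have [s1 s2 s3 s4] := W' (-1) (or_intror erefl).
rewrite mxE -/a -/b divr_ge0// /weight /dirx /diry.
rewrite /weight in p1 p2 p3 p4 q1 q2 q3 q4 r1 r2 r3 r4 s1 s2 s3 s4.
by case: j => [[|[|[|[|//]]]] ?]; case: i => [[|[|[|[|//]]]] ?] /=; lra.
Qed.

(** For equal parameters [s] the weight is [4 - 3 * s + s * (A + B)] when
p = q = 1 and [s * (1 + A + B)] otherwise, with [A + B >= - r]. *)
Lemma collision_ge0_of_l1norm lam s r V :
  0 < lam -> 0 <= s -> r <= 1 -> s * r <= 4 - 3 * s -> l1norm V <= lam * r ->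
  forall j i, 0 <= collision_mx lam s s V j i.
Proof.
move=> lam0 s0 r1 sr Vr j i.
have lam_neq0 : lam != 0 by rewrite gt_eqF.
rewrite mxE divr_ge0//; set a := V.1 / lam; set b := V.2 / lam.
have abr : `|a| + `|b| <= r.
  have lam_norm z : lam * `|z / lam| = `|z|.
    by rewrite -{1}(gtr0_norm lam0) -normrM mulrC divfK.
  by rewrite -(ler_pM2l lam0) mulrDr !lam_norm.
have sgn (z : R) e : e = 1 \/ e = -1 -> - `|z| <= e * z.
  by case=> ->; [rewrite mul1r lerNl -normrN | rewrite mulN1r lerN2]; exact: ler_norm.
have sab : - (s * r) <= s * (dirx j * a + diry j * b).
  rewrite -mulrN ler_wpM2l//.
  have /(sgn a) : dirx j = 1 \/ dirx j = -1.
    by rewrite /dirx; case: j => [[|[|[|[|//]]]] ?] /=; [left|right|right|left].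
  have /(sgn b) : diry j = 1 \/ diry j = -1.
    by rewrite /diry; case: j => [[|[|[|[|//]]]] ?] /=; [left|left|right|right].
  lra.
have : s * r <= s by rewrite -[leRHS]mulr1 ler_wpM2l.
move: sab; rewrite /weight subrr mul0r subr0.
set c := s * (_ + _) => sab srs.
by rewrite /dirx /diry; case: {sab}j @c sab => [[|[|[|[|//]]]] ?];
   case: i => [[|[|[|[|//]]]] ?] c sab /=; lra.
Qed.

(** Sums over the outgoing velocity [j] of the entries whose incoming velocity is
[j], opposite to [j], or the reflection of [j] across the x axis: the velocity
[V] cancels in each of them. *)
Lemma relax_params_bounds lam sq sxy V :
  (forall j i, 0 <= collision_mx lam sq sxy V j i) ->
  [/\ 0 <= 4 - 2 * sq - sxy, 0 <= 2 * sq - sxy & 0 <= sxy].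
Proof.
move=> A0; pose o k : 'I_4 := inord k.
have S (k l m n : nat) := addr_ge0 (addr_ge0 (addr_ge0
  (A0 (o 0%N) (o k)) (A0 (o 1%N) (o l))) (A0 (o 2%N) (o m))) (A0 (o 3%N) (o n)).
split.
- move: (S 0 1 2 3)%N; rewrite !mxE /weight /dirx /diry !inordK//=.
  by set a := V.1 / lam; set b := V.2 / lam; lra.
- move: (S 2 3 0 1)%N; rewrite !mxE /weight /dirx /diry !inordK//=.
  by set a := V.1 / lam; set b := V.2 / lam; lra.
- move: (S 3 2 1 0)%N; rewrite !mxE /weight /dirx /diry !inordK//=.
  by set a := V.1 / lam; set b := V.2 / lam; lra.
Qed.

End Twisted.

Theorem proposition3p9 (R : realType) (dx dt : R) (hdx : 0 < dx) (hdt : 0 < dt) :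
  let lam := dx / dt in
  (forall sq sxy : R,
    (sq < sxy -> sxy <= Num.min (2 * sq) (2 * (2 - sq)) ->
       forall V : R * R,
         stability_region (fun a b => a <= b) lam sq sxy V ->
         scheme_stable dx dt sq sxy V)
    /\
    (sxy <= Num.min sq (2 * (2 - sq)) -> sxy != sq ->
       forall V : R * R,
         stability_region (fun a b => a >= b) lam sq sxy V ->
         scheme_stable dx dt sq sxy V)
    /\
    (sxy = sq ->
       (0 <= sq <= 1 ->
          forall V : R * R, l1norm V <= lam -> scheme_stable dx dt sq sxy V)
       /\
       (1 <= sq <= 4 / 3 ->
          forall V : R * R, l1norm V <= lam * (4 / sq - 3) ->
            scheme_stable dx dt sq sxy V)
       /\
       (~ (0 <= sq <= 1) -> ~ (1 <= sq <= 4 / 3) ->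
          ~ exists V : R * R, scheme_stable dx dt sq sxy V))
    /\
    (~ (sq < sxy /\ sxy <= Num.min (2 * sq) (2 * (2 - sq))) ->
     ~ (sxy <= Num.min sq (2 * (2 - sq)) /\ sxy != sq) ->
     sxy <> sq ->
       ~ exists V : R * R, scheme_stable dx dt sq sxy V))
  /\
  (forall sq sxy : R,
     (exists V : R * R, scheme_stable dx dt sq sxy V) ->
     0 <= sq <= 2 /\ 0 <= sxy <= 2).
Proof.
move=> lam.
have lam0 : 0 < lam by rewrite divr_gt0.
have stableP sq sxy V : scheme_stable dx dt sq sxy V <-> _ :=
  scheme_stableP dx dt sq sxy V hdx hdt.
have bounds sq sxy V : scheme_stable dx dt sq sxy V ->
    [/\ 0 <= 4 - 2 * sq - sxy, 0 <= 2 * sq - sxy & 0 <= sxy].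
  by move=> /stableP /relax_params_bounds.
split=> sq sxy; last first.
  by move=> [V /bounds[h1 h2 h3]]; split; apply/andP; split; lra.
split; last split; last split.
- move=> lt_s _ V region; apply/stableP.
  apply: (collision_ge0_of_region _ _ _ _ _ _ lam0 _ region) => [x y xy|].
    by rewrite mulr_le0// subr_le0// ltW.
  by rewrite gt_eqF.
- rewrite le_min => /andP[le_s _] neq V region; apply/stableP.
  apply: (collision_ge0_of_region _ _ _ _ _ _ lam0 neq region) => x y xy.
  by rewrite mulr_ge0// subr_ge0.
- move=> ->; split; last split.
  + move=> /andP[s0 s1] V Vlam; apply/stableP.
    by apply: (collision_ge0_of_l1norm _ _ 1) => //; rewrite ?mulr1//; lra.
  + move=> /andP[s1 s43] V Vlam; apply/stableP.
    have s0 : 0 < sq by lra.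
    have inv_le1 : sq^-1 <= 1 by rewrite invf_le1.
    have sE : sq * (4 / sq - 3) = 4 - 3 * sq by field; rewrite gt_eqF.
    by apply: (collision_ge0_of_l1norm _ _ (4 / sq - 3)) => //;
       [exact: ltW | lra | rewrite sE].
  + move=> n1 n2 [V /bounds[h1 h2 h3]].
    have [s1|s1] := leP sq 1; [apply: n1|apply: n2]; apply/andP; split; lra.
- move=> n1 n2 neq [V /bounds[h1 h2 h3]].
  have [lt_s|lt_s|eq_s] := ltgtP sq sxy.
  + by apply: n1; split=> //; rewrite le_min; apply/andP; split; lra.
  + apply: n2; rewrite le_min lt_eqF//; split=> //.
    by apply/andP; split; lra.
  + exact/neq/esym.
Qed.
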